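(* Let $a_1,a_2,a_3$ be pairwise coprime positive integers, let $L=\{\mathbf{x}\in\mathbb{Z}^3: a_1x_1+a_2x_2+a_3x_3=0\}$, and let $l_i$, $x_{ij}$ and $\mathbf{f}_1,\mathbf{f}_2,\mathbf{f}_3$ be as in the context, with $l_i\ge 2$ for $i=1,2,3$. Let $(\mathbf{u},\mathbf{v})$ be a reduced basis of $L$ with respect to the norm $|\mathbf{x}|=\sqrt{\mathbf{x}^TQ\mathbf{x}}$, where $$Q=\begin{pmatrix}a_1^2&-a_1a_2&0\\-a_1a_2&a_2^2&0\\0&0&3a_3^2\end{pmatrix}.$$ Assume $\mathbf{u}=(u_1,u_2,u_3)$ satisfies $u_1\le 0$, $u_2\le 0$, $u_3>0$, and put $\lambda:=v_3/u_3$, where $\mathbf{v}=(v_1,v_2,v_3)$. Then the three vectors $$\mathbf{u},\qquad \mathbf{v}_-:=\mathbf{v}-\lceil\lambda\rceil\mathbf{u},\qquad \mathbf{v}_+:=\mathbf{v}-\lfloor\lambda\rfloor\mathbf{u}$$ form a solution basis, i.e. there are signs $\varepsilon_1,\varepsilon_2,\varepsilon_3\in\{\pm1\}$ with $\{\mathbf{u},\mathbf{v}_-,\mathbf{v}_+\}=\{\varepsilon_1\mathbf{f}_1,\varepsilon_2\mathbf{f}_2,\varepsilon_3\mathbf{f}_3\}$.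
   Context: $\mathbb{N}=\{0,1,2,\dots\}$; $T(b,c)=\{xb+yc: x,y\in\mathbb{N}\}$. For $i\in\{1,2,3\}$ and $\{j,k\}=\{1,2,3\}\setminus\{i\}$, $l_i:=\min\{l\in\mathbb{N}_{>0}: la_i\in T(a_j,a_k)\}$, and $x_{ij},x_{ik}\in\mathbb{N}$ are the (under these hypotheses unique) coefficients with $l_ia_i=x_{ij}a_j+x_{ik}a_k$. The basic vectors are $\mathbf{f}_1=(l_1,-x_{12},-x_{13})$, $\mathbf{f}_2=(-x_{21},l_2,-x_{23})$, $\mathbf{f}_3=(-x_{31},-x_{32},l_3)$, all in $L$. The form $\mathbf{x}^TQ\mathbf{x}$ is positive definite on the plane $a_1x_1+a_2x_2+a_3x_3=0$. A reduced basis of $L$ is a basis $(\mathbf{u},\mathbf{v})$ of $L$ such that $\mathbf{u}$ is a shortest nonzero vector of $L$ and $\mathbf{v}$ is a shortest vector of $L\setminus\mathbb{Z}\mathbf{u}$ (for the norm $|\cdot|$). *)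

(* Defs.v *)
From HB Require Import structures.
From mathcomp Require Import all_boot all_order all_algebra.
From mathcomp Require Import boolp classical_sets reals.

Set Implicit Arguments.
Unset Strict Implicit.
Unset Printing Implicit Defensive.

Import Order.TTheory GRing.Theory Num.Theory.

Local Open Scope classical_set_scope.
Local Open Scope ring_scope.

(* The indices 1, 2, 3 of the mathematical text are the elements 0, 1, 2 of
   'I_3; vectors of Z^3 are columns, with i-th coordinate [x i 0]. *)

(* T(b, c). *)
Definition semigroup2 (b c : nat) : set nat :=
  [set n | exists x y : nat, n = (x * b + y * c)%N].

Definition lattice (a : 'I_3 -> nat) : set 'cV[int]_3 :=
  [set x | \sum_(i < 3) (a i)%:Z * x i 0 = 0].

Definition least_multiplier (b c d l : nat) : Prop :=
  [/\ (0 < l)%N, semigroup2 c d (l * b)%N &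
      forall m : nat, (0 < m)%N -> semigroup2 c d (m * b)%N -> (l <= m)%N].

(* [l i] is l_i and [x i j] is x_ij for j != i; the diagonal values [x i i]
   are unconstrained and never used. *)
Definition basic_data (a l : 'I_3 -> nat) (x : 'I_3 -> 'I_3 -> nat) : Prop :=
  forall i j k : 'I_3, uniq [:: i; j; k] ->
    least_multiplier (a i) (a j) (a k) (l i) /\
    (l i * a i = x i j * a j + x i k * a k)%N.

Definition basic_vector (l : 'I_3 -> nat) (x : 'I_3 -> 'I_3 -> nat)
    (i : 'I_3) : 'cV[int]_3 :=
  \col_j (if j == i then (l i)%:Z else - (x i j)%:Z).

Definition Qmx (a : 'I_3 -> nat) : 'M[int]_3 :=
  let a1 := (a 0)%:Z in let a2 := (a 1)%:Z in let a3 := (a 2)%:Z in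
  \matrix_(i < 3, j < 3)
    nth 0 (nth [::] [:: [:: a1 ^+ 2;   - (a1 * a2); 0];
                        [:: - (a1 * a2); a2 ^+ 2;   0];
                        [:: 0;           0;         3 * a3 ^+ 2]] i) j.

Definition Qnorm (R : realType) (a : 'I_3 -> nat) (x : 'cV[int]_3) : R :=
  Num.sqrt (((x^T *m Qmx a *m x) 0 0)%:~R).

Definition lattice_basis (L : set 'cV[int]_3) (u v : 'cV[int]_3) : Prop :=
  [/\ L u, L v,
      forall m n : int, m *: u + n *: v = 0 -> m = 0 /\ n = 0 &
      forall w, L w -> exists m n : int, w = m *: u + n *: v].

Definition shortest (R : realType) (N : 'cV[int]_3 -> R)
    (A : set 'cV[int]_3) (w : 'cV[int]_3) : Prop :=
  A w /\ forall w', A w' -> N w <= N w'.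

Definition reduced_basis (R : realType) (N : 'cV[int]_3 -> R)
    (L : set 'cV[int]_3) (u v : 'cV[int]_3) : Prop :=
  [/\ lattice_basis L u v,
      shortest N (L `\ 0) u &
      shortest N (L `\` range (fun m : int => m *: u)) v].

Definition solution_basis (l : 'I_3 -> nat) (x : 'I_3 -> 'I_3 -> nat)
    (w1 w2 w3 : 'cV[int]_3) : Prop :=
  exists eps : 'I_3 -> int,
    (forall i, eps i = 1 \/ eps i = -1) /\
    [set w1; w2; w3] = range (fun i : 'I_3 => eps i *: basic_vector l x i).

(* Main.v *)
(* On L, with y_i = a_i x_i, one has x^T Q x = 2 (y_1^2 + y_2^2 + y_3^2).
   Minimality of the l_i, coprimality and l_i >= 2 give 0 < x_ij < l_j,
   f_1 + f_2 + f_3 = 0, and that the f_i span L (subtracting from w the f_i of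
   its own sign sector strictly decreases max |y_i|).  A vector of L in the
   sector (-, -, +) is then p f_3 + n f_i with p > 0, n >= 0 and i in {1, 2};
   when n > 0 it is longer than the other f_j (j <> i, 3), so the shortest vector
   u is f_3.  As (u, v) is a basis, v = +- f_1 + b f_3, and 0 < x_13 < l_3
   determines the floor and the ceiling of v_3 / u_3. *)
Require Import Defs.
From HB Require Import structures.
From mathcomp Require Import all_boot all_order all_algebra.
From mathcomp Require Import boolp classical_sets reals.
From mathcomp Require Import zify ring.

Set Implicit Arguments.
Unset Strict Implicit.
Unset Printing Implicit Defensive.

Import Order.TTheory GRing.Theory Num.Theory.

Local Open Scope ring_scope.

(** * Sums and case analysis over an arbitrary ordering of the three indices *)

Lemma mem_uniq3 (i j k : 'I_3) : uniq [:: i; j; k] -> index_enum 'I_3 =i [:: i; j; k].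
Proof.
move=> ijk s.
have sub : {subset [:: i; j; k] <= index_enum 'I_3} by move=> t _; apply: mem_index_enum.
have [|_ ->] := uniq_min_size ijk sub => //.
by rewrite [index_enum _]unlock -enumT size_enum_ord.
Qed.

Lemma I3_case (i j k s : 'I_3) : uniq [:: i; j; k] -> [\/ s = i, s = j | s = k].
Proof.
by move/mem_uniq3/(_ s); rewrite mem_index_enum !inE => /esym/or3P[] /eqP ->;
  [constructor 1 | constructor 2 | constructor 3].
Qed.

Lemma sum_I3 (V : nmodType) (F : 'I_3 -> V) (i j k : 'I_3) :
  uniq [:: i; j; k] -> \sum_s F s = F i + F j + F k.
Proof.
move=> ijk; have -> : F i + F j + F k = \sum_(s <- [:: i; j; k]) F s.
  by rewrite !big_cons big_nil addr0 addrA.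
by apply/perm_big/uniq_perm => //; [apply: index_enum_uniq | apply: mem_uniq3].
Qed.

(** * Least multipliers and positivity of the coefficients *)

(** Moving the nonpositive terms to the other side writes [p * b] as an element of T(c, d), so [p]
    competes in the minimum defining [l]. This turns minimality into a bound on lattice
    coordinates. *)
Lemma least_multiplier_min (b c d l : nat) (p q r : int) :
  least_multiplier b c d l -> b%:Z * p + c%:Z * q + d%:Z * r = 0 ->
  0 < p -> q <= 0 -> r <= 0 -> l%:Z <= p.
Proof.
case=> _ _ lmin E p0 q0 r0.
case: p p0 E => // p p0 E.
case: (intP q) q0 E => // [|q'] _ E; case: (intP r) r0 E => // [|r'] _ E.
all: have := lmin p; rewrite lez_nat; apply => //.
- by exists 0%N, 0%N; lia.
- by exists 0%N, r'.+1; lia.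
- by exists q'.+1, 0%N; lia.
- by exists q'.+1, r'.+1; lia.
Qed.

(* If y = 0, coprimality forces l >= d; but c is not in T(b, d), so reducing
   c modulo d to s b with 0 < s < d gives s b in T(c, d), i.e. l < d. *)
Lemma least_multiplier_coeff_gt0 (b c d l m y z : nat) :
  coprime b d -> (0 < b)%N -> (0 < d)%N ->
  least_multiplier b c d l -> (l * b = y * c + z * d)%N ->
  least_multiplier c b d m -> (2 <= m)%N -> (0 < y)%N.
Proof.
move=> cop b0 d0 [l0 _ lmin] E [_ _ mmin] m2.
rewrite lt0n; apply/eqP => y0; move: E; rewrite y0 mul0n add0n => E.
have dl : (d %| l)%N.
  by rewrite -(Gauss_dvdl _ (_ : coprime d b)) 1?coprime_sym // E dvdn_mull.
have dle : (d <= l)%N by apply: dvdn_leq.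
have c_notin s t : (c <> s * b + t * d)%N.
  move=> cE; have := mmin 1%N isT; rewrite mul1n => /(_ _).
  by move=> H; have: (m <= 1)%N by [apply: H; exists s, t]; lia.
(* The Chinese remainder [e] is a multiple [q * b] congruent to [c] modulo [d]; reducing [q] modulo
   [d] keeps the congruence and yields the multiplier [s < d]. *)
pose e := chinese b d 0 c.
have /dvdnP[q eE] : (b %| e)%N by rewrite /dvdn chinese_modl // mod0n.
have eC : (e = c %[mod d])%N by rewrite chinese_modr.
have sC : ((q %% d) * b = c %[mod d])%N by rewrite modnMml -eE.
have lt_d : (q %% d < d)%N by rewrite ltn_mod.
move: (q %% d)%N sC lt_d => s sC lt_d.
have [le|/ltnW le] := leqP (s * b) c.
  move/eqP: sC; rewrite eq_sym eqn_mod_dvd // => /dvdnP[t tE].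
  by apply: (c_notin s t); lia.
move/eqP: sC; rewrite eqn_mod_dvd // => /dvdnP[t tE].
have s0 : (0 < s)%N.
  rewrite lt0n; apply/eqP => s0; apply: (c_notin 0 0)%N; lia.
have := lmin s s0 => H; have: (l <= s)%N by apply: H; exists 1%N, t; lia.
lia.
Qed.

Lemma basic_coeff_gt0 (a l : 'I_3 -> nat) (x : 'I_3 -> 'I_3 -> nat) :
  (forall i, 0 < a i)%N -> (forall i j, i != j -> coprime (a i) (a j)) ->
  basic_data a l x -> (forall i, 2 <= l i)%N ->
  forall i j k, uniq [:: i; j; k] -> (0 < x i j)%N.
Proof.
move=> a0 cop D l2 i j k ijk.
have jik : uniq [:: j; i; k] by rewrite (uniq_catCA [:: j] [:: i] [:: k]).
have [D1 E1] := D _ _ _ ijk; have [D2 _] := D _ _ _ jik.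
apply: (least_multiplier_coeff_gt0 _ _ _ D1 E1 D2) => //.
by apply: cop; move: ijk; rewrite /= !inE negb_or => /andP[/andP[]].
Qed.

(** * The lattice and its sign sectors *)

Lemma latticeE (a : 'I_3 -> nat) (w : 'cV[int]_3) (i j k : 'I_3) :
  uniq [:: i; j; k] -> lattice a w <->
  (a i)%:Z * w i 0 + (a j)%:Z * w j 0 + (a k)%:Z * w k 0 = 0.
Proof. by move=> ijk; rewrite /lattice /= (sum_I3 _ ijk). Qed.

Lemma latticeB (a : 'I_3 -> nat) (w w' : 'cV[int]_3) :
  lattice a w -> lattice a w' -> lattice a (w - w').
Proof.
move=> E E'; rewrite /lattice /= in E E' *.
transitivity (\sum_(i < 3) (a i)%:Z * w i 0 - \sum_(i < 3) (a i)%:Z * w' i 0).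
  by rewrite -sumrB; apply: eq_bigr => i _; rewrite !mxE mulrBr.
by rewrite E E' subrr.
Qed.

Lemma lattice0 (a : 'I_3 -> nat) : lattice a 0.
Proof. by rewrite /lattice /= big1 // => i _; rewrite mxE mulr0. Qed.

Lemma latticeN (a : 'I_3 -> nat) (w : 'cV[int]_3) : lattice a w -> lattice a (- w).
Proof. by move=> Lw; rewrite -sub0r; apply: latticeB => //; apply: lattice0. Qed.

(** Positive weights force both signs to occur in a nonzero solution, so up to a global sign exactly
    one coordinate is positive. The mirrored cases are phrased with opposites so that they are
    literally the first ones for the negated vector. *)
Lemma weighted_sum0_signs (b c d p q r : int) :
  0 < b -> 0 < c -> 0 < d -> b * p + c * q + d * r = 0 ->
  [\/ p = 0 /\ q = 0 /\ r = 0,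
      (0 < p /\ q <= 0 /\ r <= 0) \/ (0 < - p /\ - q <= 0 /\ - r <= 0),
      (0 < q /\ r <= 0 /\ p <= 0) \/ (0 < - q /\ - r <= 0 /\ - p <= 0) |
      (0 < r /\ p <= 0 /\ q <= 0) \/ (0 < - r /\ - p <= 0 /\ - q <= 0)].
Proof.
move=> b0 c0 d0 E.
case: (ltrgt0P p) => Hp; case: (ltrgt0P q) => Hq; case: (ltrgt0P r) => Hr;
  try (exfalso; nia).
all: first [ constructor 1; lia | constructor 2; lia | constructor 3; lia | constructor 4; lia ].
Qed.

Lemma lattice_sign_cases (a : 'I_3 -> nat) (w : 'cV[int]_3) :
  (forall i, 0 < a i)%N -> lattice a w ->
  w = 0 \/ exists i j k, uniq [:: i; j; k] /\
    ((0 < w i 0 /\ w j 0 <= 0 /\ w k 0 <= 0) \/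
     (0 < - w i 0 /\ - w j 0 <= 0 /\ - w k 0 <= 0)).
Proof.
move=> a0 /(@latticeE _ _ 0 1 2 isT) E.
have aZ i : 0 < (a i)%:Z by rewrite ltz_nat.
have [[w0 [w1 w2]]|S|S|S] := weighted_sum0_signs (aZ 0) (aZ 1) (aZ 2) E.
- left; apply/colP => s; rewrite mxE.
  by have [->|->|->] := @I3_case 0 1 2 s isT.
- by right; exists 0, 1, 2.
- by right; exists 1, 2, 0.
- by right; exists 2, 0, 1.
Qed.

Lemma lattice_min (a l : 'I_3 -> nat) (x : 'I_3 -> 'I_3 -> nat) (w : 'cV[int]_3)
    (i j k : 'I_3) :
  basic_data a l x -> lattice a w -> uniq [:: i; j; k] ->
  0 < w i 0 -> w j 0 <= 0 -> w k 0 <= 0 -> (l i)%:Z <= w i 0.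
Proof.
move=> D Lw ijk; have [Dl _] := D _ _ _ ijk.
by apply: (least_multiplier_min Dl); apply/latticeE.
Qed.

(** * The basic vectors and their sum *)

Lemma basic_vector_diag (l : 'I_3 -> nat) (x : 'I_3 -> 'I_3 -> nat) (i : 'I_3) :
  basic_vector l x i i 0 = (l i)%:Z.
Proof. by rewrite mxE eqxx. Qed.

Lemma basic_vector_offdiag (l : 'I_3 -> nat) (x : 'I_3 -> 'I_3 -> nat) (i j : 'I_3) :
  j != i -> basic_vector l x i j 0 = - (x i j)%:Z.
Proof. by rewrite mxE => /negbTE ->. Qed.

Lemma uniq3_neqs (i j k : 'I_3) : uniq [:: i; j; k] ->
  [/\ j != i, k != i, i != j & [/\ k != j, i != k & j != k]].
Proof.
rewrite /= !inE negb_or andbT => /andP[/andP[ij ik] jk].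
by rewrite ![_ == i]eq_sym [k == j]eq_sym ij ik jk.
Qed.

Lemma uniq3C (i j k : 'I_3) : uniq [:: i; j; k] -> uniq [:: j; i; k].
Proof. by rewrite (uniq_catCA [:: j] [:: i] [:: k]). Qed.

Lemma uniq3_rot (i j k : 'I_3) : uniq [:: i; j; k] -> uniq [:: j; k; i].
Proof. by rewrite -(rot_uniq 1). Qed.

Lemma lattice_basic_vector (a l : 'I_3 -> nat) (x : 'I_3 -> 'I_3 -> nat) (i : 'I_3) :
  basic_data a l x -> lattice a (basic_vector l x i).
Proof.
move=> D; have [j [k ijk]] : exists j k, uniq [:: i; j; k].
  by have [->|->|->] := @I3_case 0 1 2 i isT;
    [exists 1, 2 | exists 0, 2 | exists 0, 1].
have [ji ki _ _] := uniq3_neqs ijk; have [_ E] := D _ _ _ ijk.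
apply/(latticeE _ _ ijk); rewrite basic_vector_diag !basic_vector_offdiag //.
lia.
Qed.

(** If [l j <= x i j], then f_i + f_j has nonpositive coordinates at j and k, hence a positive one
    at i. That coordinate is [l i - x j i], below [l i], which contradicts minimality. *)
Lemma basic_coeff_lt (a l : 'I_3 -> nat) (x : 'I_3 -> 'I_3 -> nat) :
  (forall i, 0 < a i)%N -> basic_data a l x ->
  (forall i j k, uniq [:: i; j; k] -> 0 < x i j)%N ->
  forall i j k, uniq [:: i; j; k] -> (x i j < l j)%N.
Proof.
move=> a0 D x0 i j k ijk; rewrite ltnNge; apply/negP => lx.
have jik := uniq3C ijk.
have [Di Ei] := D _ _ _ ijk; have [_ Ej] := D _ _ _ jik.
have xik := x0 _ _ _ (uniq3C (uniq3_rot (uniq3_rot ijk))).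
have xji := x0 _ _ _ jik.
have p0 : 0 < (l i)%:Z - (x j i)%:Z by have := a0 i; have := a0 k; nia.
have := @least_multiplier_min _ _ _ _ _
  ((l j)%:Z - (x i j)%:Z) (- (x i k)%:Z - (x j k)%:Z) Di _ p0.
by lia.
Qed.

(** The i-th coordinate of the sum is [l i - x j i - x k i], which lies strictly between [- l i] and
    [l i]. A nonzero lattice vector has, up to sign, a lone positive coordinate of size at least the
    corresponding [l i]. *)
Lemma basic_vector_sum0 (a l : 'I_3 -> nat) (x : 'I_3 -> 'I_3 -> nat) :
  (forall i, 0 < a i)%N ->
  basic_data a l x ->
  (forall i j k, uniq [:: i; j; k] -> 0 < x i j < l j)%N ->
  \sum_i basic_vector l x i = 0.
Proof.
move=> a0 D xb; set s := \sum_i _.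
have sE i j k : uniq [:: i; j; k] -> s i 0 = (l i)%:Z - (x j i)%:Z - (x k i)%:Z.
  move=> ijk; have [ji ki ij [kj ik jk]] := uniq3_neqs ijk.
  by rewrite /s (sum_I3 _ ijk) !mxE eqxx (negbTE ij) (negbTE ik).
have Ls : lattice a s.
  rewrite /s (sum_I3 _ (isT : uniq [:: 0; 1; 2 : 'I_3])).
  rewrite -[X in _ + X]opprK; apply: latticeB; last first.
    by apply/latticeN/lattice_basic_vector.
  rewrite -[X in _ + X]opprK; apply: latticeB; last first.
    by apply/latticeN/lattice_basic_vector.
  exact: lattice_basic_vector.
have [//|[i [j [k [ijk S]]]]] := lattice_sign_cases a0 Ls.
have E := sE _ _ _ ijk.
have /andP[x1 x2] := xb _ _ _ (uniq3C ijk).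
have /andP[x3 x4] := xb _ _ _ (uniq3_rot (uniq3_rot ijk)).
exfalso; case: S => -[S1 [S2 S3]].
  by have := lattice_min D Ls ijk S1 S2 S3; rewrite E; lia.
have := lattice_min D (latticeN Ls) ijk; rewrite !mxE => /(_ S1 S2 S3); rewrite E; lia.
Qed.

(** * The quadratic form on the lattice *)

Lemma Qform_lattice (a : 'I_3 -> nat) (w : 'cV[int]_3) : lattice a w ->
  (w^T *m Qmx a *m w) 0 0 = 2 * \sum_i ((a i)%:Z * w i 0) ^+ 2.
Proof.
have ijk : uniq [:: 0; 1; 2 : 'I_3] by [].
move/(latticeE _ _ ijk) => E.
rewrite (sum_I3 _ ijk) mxE (sum_I3 _ ijk) !mxE !(sum_I3 _ ijk) !mxE /=.
apply/eqP; rewrite -subr_eq0; apply/eqP.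
(* With y_i = a_i w_i, the difference of the two sides is y_3^2 - (y_1 + y_2)^2, which has the
   factor y_1 + y_2 + y_3. *)
apply: etrans (_ : _ = ((a 2)%:Z * w 2 0 - (a 0)%:Z * w 0 0 - (a 1)%:Z * w 1 0) *
  ((a 0)%:Z * w 0 0 + (a 1)%:Z * w 1 0 + (a 2)%:Z * w 2 0)) _; first by ring.
by rewrite E mulr0.
Qed.

Lemma Qnorm_le (R : realType) (a : 'I_3 -> nat) (w w' : 'cV[int]_3) :
  lattice a w -> lattice a w' -> Qnorm R a w <= Qnorm R a w' ->
  \sum_i ((a i)%:Z * w i 0) ^+ 2 <= \sum_i ((a i)%:Z * w' i 0) ^+ 2.
Proof.
move=> Lw Lw'; rewrite /Qnorm !Qform_lattice // ler_sqrt ?ler_int ?ler_pM2l //.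
by rewrite ler0z mulr_ge0 // sumr_ge0 // => i _; apply: sqr_ge0.
Qed.

(** * The basic vectors span the lattice *)

(** The shifted coordinates may change sign, but then [c * (q + y) <= y * c < l * b <= b * p], and
    likewise for [d]. Strict positivity of [y] and [z] provides the drop by one. *)
Lemma descent_bounds (b c d p q r l y z N : int) :
  0 < b -> 0 < c -> 0 < d -> 0 < y -> 0 < z ->
  b * p + c * q + d * r = 0 -> l * b = y * c + z * d ->
  l <= p -> q <= 0 -> r <= 0 ->
  `|b * p| <= N + 1 -> `|c * q| <= N + 1 -> `|d * r| <= N + 1 ->
  [/\ `|b * (p - l)| <= N, `|c * (q + y)| <= N & `|d * (r + z)| <= N].
Proof.
move=> b0 c0 d0 y0 z0 Lw E lp q0 r0.
have yc : 0 < y * c by rewrite mulr_gt0.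
have zd : 0 < z * d by rewrite mulr_gt0.
have pl : 0 <= b * (p - l) by rewrite mulr_ge0 ?subr_ge0 // ltW.
have cq : c * q <= 0 by rewrite mulr_ge0_le0 // ltW.
have dr : d * r <= 0 by rewrite mulr_ge0_le0 // ltW.
by move=> *; split; lia.
Qed.

(** Induction on a bound [N] for all |a_i w_i|: the bound 0 forces [w = 0], and subtracting the
    basic vector of the sector of [w] lowers the bound. *)
Lemma basic_vector_span (a l : 'I_3 -> nat) (x : 'I_3 -> 'I_3 -> nat) (w : 'cV[int]_3) :
  (forall i, 0 < a i)%N -> basic_data a l x ->
  (forall i j k, uniq [:: i; j; k] -> 0 < x i j)%N ->
  lattice a w -> exists c : 'I_3 -> int, w = \sum_i c i *: basic_vector l x i.
Proof.
move=> a0 D x0 Lw.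
have [N] : exists N : nat, forall i, `|(a i)%:Z * w i 0| <= N%:Z.
  exists (\sum_i absz ((a i)%:Z * w i 0)%R)%N => i.
  by rewrite -abszE lez_nat (bigD1 i) //= leq_addr.
elim: N => [|N IH] in w Lw *.
  move=> w0; exists (fun=> 0); rewrite big1 => [|i _]; last by rewrite scale0r.
  by apply/colP => i; rewrite mxE; have := w0 i; have := a0 i; nia.
move=> wN.
(* Stated for a general [w'] with a positive coordinate, so that it serves both [w] and [- w]. *)
have descent w' i j k : lattice a w' -> uniq [:: i; j; k] ->
    (forall i, `|(a i)%:Z * w' i 0| <= N.+1%:Z) ->
    0 < w' i 0 /\ w' j 0 <= 0 /\ w' k 0 <= 0 ->
    exists c : 'I_3 -> int, w' = \sum_s c s *: basic_vector l x s.
  move=> Lw' ijk w'N [wi [wj wk]].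
  have li := lattice_min D Lw' ijk wi wj wk.
  have [ji ki _ _] := uniq3_neqs ijk.
  have [[li0 _ _] E] := D _ _ _ ijk.
  have xij := x0 _ _ _ ijk.
  have xik := x0 _ _ _ (uniq3C (uniq3_rot (uniq3_rot ijk))).
  have [||c cE] := IH (w' - basic_vector l x i).
  - by apply: latticeB Lw' (lattice_basic_vector _ D).
  - have EZ : (l i)%:Z * (a i)%:Z = (x i j)%:Z * (a j)%:Z + (x i k)%:Z * (a k)%:Z by lia.
    have [] := @descent_bounds (a i) (a j) (a k) (w' i 0) (w' j 0) (w' k 0)
      (l i) (x i j) (x i k) N => //.
    1-3: exact: a0.
    + exact: (latticeE _ _ ijk).1 Lw'.
    1-3: by rewrite addrC -intS.
    by move=> bi bj bk s; have [->|->|->] := I3_case s ijk;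
      rewrite mxE [X in _ + X]mxE ?basic_vector_diag ?basic_vector_offdiag // opprK.
  exists (fun s => c s + (s == i)%:R).
  under eq_bigr do rewrite scalerDl.
  rewrite big_split -cE /= (bigD1 i) //= eqxx scale1r big1 ?addr0 ?subrK //.
  by move=> s /negbTE ->; rewrite scale0r.
have [->|[i [j [k [ijk []]]]]] := lattice_sign_cases a0 Lw.
- by exists (fun=> 0); rewrite big1 // => i _; rewrite scale0r.
- by apply: descent.
have wN' s : - w s 0 = (- w) s 0 by rewrite mxE.
rewrite !wN' => S; have [||c cE] := descent _ _ _ _ (latticeN Lw) ijk.
- by move=> s; rewrite mxE mulrN normrN.
- by [].
exists (fun s => - c s); under eq_bigr do rewrite scaleNr.
by rewrite sumrN -cE opprK.
Qed.

(** * The shortest vector in a sector *)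

(** The sum of squares equals 2 (p^2 + p q + q^2), and [p * q] is nonnegative. Together with the
    next bound, it reduces comparing the lengths of two lattice vectors to comparing one
    coordinate. *)
Lemma sum_sqr_ge (p q r : int) : p + q + r = 0 -> p <= 0 -> q <= 0 ->
  2 * q ^+ 2 <= p ^+ 2 + q ^+ 2 + r ^+ 2.
Proof. by move=> E p0 q0; have -> : r = - (p + q); [lia | nia]. Qed.

Lemma sum_sqr_le (p q r : int) : p + q + r = 0 -> p <= 0 -> r <= 0 ->
  p ^+ 2 + q ^+ 2 + r ^+ 2 <= 2 * q ^+ 2.
Proof. by move=> E p0 r0; have -> : q = - (p + r); [lia | nia]. Qed.

Lemma basic_vector_sum0E (l : 'I_3 -> nat) (x : 'I_3 -> 'I_3 -> nat) (i j k : 'I_3) :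
  \sum_i basic_vector l x i = 0 -> uniq [:: i; j; k] -> l i = (x j i + x k i)%N.
Proof.
move=> f0 ijk; have [ji ki ij [kj ik jk]] := uniq3_neqs ijk.
have : (\sum_i basic_vector l x i) i 0 = 0 by rewrite f0 mxE.
by rewrite (sum_I3 _ ijk) !mxE eqxx (negbTE ij) (negbTE ik); lia.
Qed.

(** If [n > 0], then |u_j| exceeds [l j]. Half the squared norm of [u] is then at least 2 (a_j
    u_j)^2 > 2 (a_j l_j)^2, and the last term bounds the same quantity for f_j, against [le_u]. *)
Lemma sector_coeff0 (a l : 'I_3 -> nat) (x : 'I_3 -> 'I_3 -> nat) (u : 'cV[int]_3)
    (i j k : 'I_3) (p n : int) :
  (forall i, 0 < a i)%N -> basic_data a l x ->
  (forall i j k, uniq [:: i; j; k] -> 0 < x i j < l j)%N ->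
  \sum_i basic_vector l x i = 0 -> uniq [:: i; j; k] -> lattice a u ->
  \sum_s ((a s)%:Z * u s 0) ^+ 2 <= \sum_s ((a s)%:Z * basic_vector l x j s 0) ^+ 2 ->
  u i 0 <= 0 -> u j 0 <= 0 -> 0 < u k 0 ->
  u = p *: basic_vector l x k + n *: basic_vector l x i -> 0 <= n -> n = 0.
Proof.
move=> a0 D xb f0 ijk Lu le_u ui uj uk uE n0.
have [ji ki ij [kj ik jk]] := uniq3_neqs ijk.
have [//|n1] := eqVneq n 0; exfalso.
have aZ s : 0 < (a s)%:Z by rewrite ltz_nat.
have /andP[xki0 xki] := xb _ _ _ (uniq3_rot (uniq3_rot ijk)).
have /andP[xkj0 xkj] := xb _ _ _ (uniq3C (uniq3_rot ijk)).
have lj := basic_vector_sum0E f0 (uniq3C ijk).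
have [uiE [ujE ukE]] : u i 0 = - p * (x k i)%:Z + n * (l i)%:Z /\
    u j 0 = - p * (x k j)%:Z - n * (x i j)%:Z /\
    u k 0 = p * (l k)%:Z - n * (x i k)%:Z.
  rewrite uE !mxE !eqxx (negbTE ik) (negbTE ji) (negbTE jk) (negbTE ki).
  by split; [|split]; ring.
(* [u k 0 > 0] gives [p > 0]; then [u i 0 <= 0] reads n l_i <= p x_ki < p l_i. *)
have p0 : 0 < p by move: uk; rewrite ukE; nia.
have np : n < p by move: ui; rewrite uiE; nia.
(* u = (p - n) f_k - n f_j with p - n > 0. *)
have uj_lt : u j 0 < - (l j)%:Z by rewrite ujE lj PoszD; nia.
have lower := sum_sqr_ge ((latticeE _ _ ijk).1 Lu)
  (mulr_ge0_le0 (ltW (aZ i)) ui) (mulr_ge0_le0 (ltW (aZ j)) uj).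
have upper := sum_sqr_le ((latticeE _ _ ijk).1 (lattice_basic_vector j D)).
have neg y s : (a s)%:Z * - (y : nat)%:Z <= 0 by rewrite mulr_ge0_le0 ?oppr_le0 // ltW.
move: upper le_u; rewrite !(sum_I3 _ ijk) basic_vector_diag !basic_vector_offdiag //.
move=> /(_ (neg _ _) (neg _ _)) upper le_u.
have sq_lt : ((a j)%:Z * (l j)%:Z) ^+ 2 < ((a j)%:Z * u j 0) ^+ 2.
  rewrite -[ltRHS]sqrrN -mulrN ltr_pXn2r ?nnegrE ?mulr_ge0 ?oppr_ge0 //.
  by rewrite ltr_pM2l // ltrNr.
have := le_trans (le_trans lower le_u) upper.
by rewrite leNgt ltr_pM2l // sq_lt.
Qed.

(** * Rounding, and coefficients with respect to a lattice basis *)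

Lemma floor_ratio (R : realType) (d n b r : int) : 0 < r < d -> n = b * d + r ->
  Num.floor (n%:~R / d%:~R : R) = b /\ Num.ceil (n%:~R / d%:~R : R) = b + 1.
Proof.
move=> /andP[r0 rd] ->; have d0 : 0 < d%:~R :> R by rewrite ltr0z (lt_trans r0).
have bounds : b%:~R < (b * d + r)%:~R / d%:~R :> R /\
    (b * d + r)%:~R / d%:~R < (b + 1)%:~R :> R.
  by rewrite ltr_pdivlMr // ltr_pdivrMr // -!intrM !ltr_int; lia.
case: bounds => lo hi; split.
  by apply: floor_def; rewrite (ltW lo) hi.
by apply: ceil_def; rewrite addrK lo (ltW hi).
Qed.

Lemma solution_basisI (l : 'I_3 -> nat) (x : 'I_3 -> 'I_3 -> nat)
    (e : 'I_3 -> int) (i j k : 'I_3) :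
  uniq [:: i; j; k] -> (forall s, e s = 1 \/ e s = -1) ->
  solution_basis l x (e i *: basic_vector l x i) (e j *: basic_vector l x j)
    (e k *: basic_vector l x k).
Proof.
move=> ijk e1; exists e; split => //; apply/seteqP; split => w /=.
  by move=> [[]|] ->; [exists i | exists j | exists k].
case=> s _ <-; have [->|->|->] := I3_case s ijk;
  by [left; left | left; right | right].
Qed.

Lemma intM_eq1 (p m : int) : p * m = 1 -> p = 1 \/ p = -1.
Proof.
move/(congr1 absz); rewrite abszM => /eqP.
by rewrite muln_eq1 => /andP[/eqP]; lia.
Qed.

(** Expanding [w = m u + n v] and comparing coefficients of [u] gives [p * m = 1]. *)
Lemma lattice_basis_primitive (L : set 'cV[int]_3) (u v w : 'cV[int]_3) (p : int) :
  lattice_basis L u v -> L w -> u = p *: w -> 0 < p -> p = 1.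
Proof.
move=> [_ _ free span] Lw uE p0; have [m [n wE]] := span w Lw.
have [] := free (p * m - 1) (p * n).
  rewrite scalerBl scale1r addrAC -!scalerA -scalerDr -wE -uE subrr //.
by move/eqP; rewrite subr_eq0 => /eqP/intM_eq1 [-> //|pN _]; lia.
Qed.

(** Expanding [w = m u + n v] and comparing coefficients of [v] gives [c * n = 1]. *)
Lemma lattice_basis_complement (L : set 'cV[int]_3) (u v w : 'cV[int]_3) (b c : int) :
  lattice_basis L u v -> L w -> v = c *: w + b *: u -> c = 1 \/ c = -1.
Proof.
move=> [_ _ free span] Lw vE; have [m [n wE]] := span w Lw.
have [] := free (c * m + b) (c * n - 1).
  rewrite scalerDl scalerBl scale1r -!scalerA addrACA -scalerDr -wE.
  by rewrite addrA -vE subrr.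
by move=> _ /eqP; rewrite subr_eq0 => /eqP/intM_eq1.
Qed.

Lemma sum0_combine (f g h : 'cV[int]_3) (b c d : int) : f + g + h = 0 ->
  b *: f + c *: g + d *: h = (d - c) *: h + (b - c) *: f.
Proof.
move=> fgh; have -> : g = - f - h.
  by apply/eqP; rewrite -subr_eq0 !opprD !opprK addrA [g + _]addrC fgh.
by apply/colP => s; rewrite !mxE; ring.
Qed.

(** * Identification of the three vectors *)

Theorem theorem7 (R : realType) (a l : 'I_3 -> nat)
    (x : 'I_3 -> 'I_3 -> nat) (u v : 'cV[int]_3)
    (a_gt0 : forall i, (0 < a i)%N)
    (a_coprime : forall i j, i != j -> coprime (a i) (a j))
    (lx_def : basic_data a l x)
    (l_ge2 : forall i, (2 <= l i)%N)
    (uv_reduced : reduced_basis (Qnorm R a) (lattice a) u v)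
    (u1_le0 : u 0 0 <= 0) (u2_le0 : u 1 0 <= 0) (u3_gt0 : 0 < u 2 0) :
  let lambda : R := (v 2 0)%:~R / (u 2 0)%:~R in
  let v_minus := v - Num.ceil lambda *: u in
  let v_plus := v - Num.floor lambda *: u in
  solution_basis l x u v_minus v_plus.
Proof.
have x_gt0 := basic_coeff_gt0 a_gt0 a_coprime lx_def l_ge2.
have xb i j k : uniq [:: i; j; k] -> (0 < x i j < l j)%N.
  by move=> ijk; rewrite (x_gt0 _ _ _ ijk) (basic_coeff_lt a_gt0 lx_def x_gt0 ijk).
have f0 := basic_vector_sum0 a_gt0 lx_def xb.
have ijk : uniq [:: 0; 1; 2 : 'I_3] by [].
case: uv_reduced => uv_basis [[Lu _] u_min] _.
have [_ Lv _ _] := uv_basis.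
set f := basic_vector l x in f0 *.
have Lf i : lattice a (f i) by apply: lattice_basic_vector.
have u_le i : \sum_s ((a s)%:Z * u s 0) ^+ 2 <= \sum_s ((a s)%:Z * f i s 0) ^+ 2.
  apply: (@Qnorm_le R) => //; apply: u_min; split => // /(congr1 (fun w : 'cV[int]_3 => w i 0)).
  by rewrite basic_vector_diag mxE; have := l_ge2 i; lia.
have f012 : f 0 + f 1 + f 2 = 0 by rewrite -(sum_I3 _ ijk).
have pos_u p : u = p *: f 2 -> 0 < p.
  by move=> uE; move: u3_gt0; rewrite uE mxE basic_vector_diag; nia.
have [p uE] : exists p, u = p *: f 2.
  have [c cE] := basic_vector_span a_gt0 lx_def x_gt0 Lu.
  rewrite -/f (sum_I3 _ ijk) in cE.
  (* Of [f 0] and [f 1], the one with the smaller coefficient is eliminated through [f012], so that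
     the other keeps a nonnegative coefficient. *)
  have [le_c|/ltW le_c] := lerP (c 1) (c 0).
    have u20 : u = (c 2 - c 1) *: f 2 + (c 0 - c 1) *: f 0.
      by rewrite cE (sum0_combine _ _ _ f012).
    have n0 := sector_coeff0 a_gt0 lx_def xb f0 ijk Lu (u_le 1)
      u1_le0 u2_le0 u3_gt0 u20 (_ : 0 <= c 0 - c 1).
    by exists (c 2 - c 1); rewrite u20 n0 ?scale0r ?addr0 // subr_ge0.
  have u21 : u = (c 2 - c 0) *: f 2 + (c 1 - c 0) *: f 1.
    by rewrite cE [c 0 *: _ + _]addrC sum0_combine // [f 1 + _]addrC.
  have n0 := sector_coeff0 a_gt0 lx_def xb f0 (uniq3C ijk) Lu (u_le 0)
    u2_le0 u1_le0 u3_gt0 u21 (_ : 0 <= c 1 - c 0).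
  by exists (c 2 - c 0); rewrite u21 n0 ?scale0r ?addr0 // subr_ge0.
have p1 := lattice_basis_primitive uv_basis (Lf 2) uE (pos_u _ uE).
move: uE; rewrite p1 scale1r => uE {p p1 pos_u}.
have [c cE] := basic_vector_span a_gt0 lx_def x_gt0 Lv.
rewrite -/f (sum_I3 _ ijk) [c 0 *: _ + _]addrC in cE.
have vE : v = (c 0 - c 1) *: f 0 + (c 2 - c 1) *: u.
  by rewrite cE [c 1 *: _ + _]addrC (sum0_combine _ _ _ f012) uE addrC.
move: (c 0 - c 1) (c 2 - c 1) vE => e b vE {c cE}.
have e1 := lattice_basis_complement uv_basis (Lf 0) vE.
have u3 : u 2 0 = (l 2)%:Z by rewrite uE basic_vector_diag.
have f03 : f 0 2 0 = - (x 0 2)%:Z by rewrite basic_vector_offdiag.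
have v3 : v 2 0 = e * - (x 0 2)%:Z + b * (l 2)%:Z.
  by rewrite vE [LHS]mxE [X in X + _]mxE [X in _ + X]mxE f03 u3.
have /andP[x0 xl] := xb 0 2 1 isT.
have shift t : v - t *: u = e *: f 0 + (b - t) *: u by rewrite vE -addrA -scalerBl.
have f1E : - f 1 = f 0 + u.
  by apply/esym/eqP; rewrite -addr_eq0 uE addrAC f012.
rewrite /= !shift u3; case: e1 => e1; rewrite e1 in v3 *.
  (* Here v_3 = b l_3 - x_13 = (b - 1) l_3 + (l_3 - x_13), so the floor is [b - 1] and the ceiling
     [b]: [v_minus] is [f 0] and [v_plus] is [f 0 + u = - f 1]. *)
  have [||-> ->] := @floor_ratio R (l 2) (v 2 0) (b - 1) ((l 2)%:Z - (x 0 2)%:Z); try lia.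
  pose eps (s : 'I_3) : int := if s == 1 then -1 else 1.
  have eps1 s : eps s = 1 \/ eps s = -1 by rewrite /eps; case: ifP; [right | left].
  have -> : 1 *: f 0 + (b - (b - 1 + 1)) *: u = eps 0 *: f 0.
    by rewrite subrK subrr scale0r addr0.
  have -> : 1 *: f 0 + (b - (b - 1)) *: u = eps 1 *: f 1.
    by rewrite subKr !scale1r /eps eqxx scaleN1r f1E.
  have -> : u = eps 2 *: f 2 by rewrite scale1r.
  exact: (@solution_basisI l x eps 2 0 1).
(* Here v_3 = b l_3 + x_13, so the floor is [b] and the ceiling [b + 1]: [v_minus] is
   [- f 0 - u = f 1] and [v_plus] is [- f 0]. *)
have [||-> ->] := @floor_ratio R (l 2) (v 2 0) b (x 0 2); try lia.
pose eps (s : 'I_3) : int := if s == 0 then -1 else 1.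
have eps1 s : eps s = 1 \/ eps s = -1 by rewrite /eps; case: ifP; [right | left].
have -> : -1 *: f 0 + (b - (b + 1)) *: u = eps 1 *: f 1.
  by rewrite opprD addrA subrr add0r !scaleN1r -opprD -f1E opprK scale1r.
have -> : -1 *: f 0 + (b - b) *: u = eps 0 *: f 0.
  by rewrite subrr scale0r addr0.
have -> : u = eps 2 *: f 2 by rewrite scale1r.
exact: (@solution_basisI l x eps 2 1 0).
Qed.
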